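(* Let $r\ge1$ and let $E_{k,\ell}$ ($1\le k,\ell\le r$) be the matrix units of $\mathfrak{gl}_r(\mathbb{C})$. Write $Z:=\sum_{\ell=1}^rE_{\ell,\ell}$ for the generator of the centre of $\mathfrak{gl}_r(\mathbb{C})$. Set $K_j:=E_{j,j+1}-E_{j+1,j}$ for $1\le j<r$ and $$K_r:=iE_{r,r}=\frac{i}{r}\Bigl(Z-\sum_{j=1}^{r-1}j\,(E_{j,j}-E_{j+1,j+1})\Bigr),$$ where $i=\sqrt{-1}$. Then the Lie algebra $\mathfrak{gl}_r(\mathbb{C})$ is generated by $K_1,\ldots,K_r$, and the defining relations of $\mathfrak{gl}_r(\mathbb{C})$ in terms of the generators $K_1,\ldots,K_r$ are $$[K_j,K_k]=0,\qquad |j-k|>1,$$ $$[K_j,[K_j,K_{j+1}]]=-K_{j+1},\qquad 1\le j<r-1,$$ $$[K_{j+1},[K_{j+1},K_j]]=-K_j,\qquad 1\le j<r,$$ $$[K_{r-1},[K_{r-1},[K_{r-1},K_r]]]=-4[K_{r-1},K_r].$$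
   Context: ''Defining relations in terms of the generators'' means that $\mathfrak{gl}_r(\mathbb{C})$ is isomorphic, via the map sending generators to the $K_j$, to the complex Lie algebra presented by generators $K_1,\ldots,K_r$ and the listed relations. Relations involving an index outside $\{1,\ldots,r\}$ are absent (for $r=1$ there are no relations). *)

(* Defs.v *)
From HB Require Import structures.
From mathcomp Require Import all_boot all_order all_algebra generic_quotient.
From mathcomp Require Import boolp classical_sets reals ring.
From mathcomp.real_closed Require Import complex.

Set Implicit Arguments.
Unset Strict Implicit.
Unset Printing Implicit Defensive.

Import GRing.Theory.
Local Open Scope ring_scope.
Local Open Scope quotient_scope.

Reserved Notation "[Lie x , y ]" (at level 0, x, y at level 99,
  format "[Lie  x ,  y ]").

HB.mixin Record Lmodule_isLieAlgebra (F : fieldType) (L : Type)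
    of GRing.Lmodule F L := {
  lie_bracket : L -> L -> L;
  lie_linearl : forall y, linear (fun x => lie_bracket x y);
  lie_linearr : forall x, linear (fun y => lie_bracket x y);
  lie_alternating : forall x, lie_bracket x x = 0;
  lie_jacobi : forall x y z,
    lie_bracket x (lie_bracket y z) + lie_bracket y (lie_bracket z x)
      + lie_bracket z (lie_bracket x y) = 0
}.

#[short(type="lieAlgType")]
HB.structure Definition LieAlgebra (F : fieldType) :=
  {L of GRing.Lmodule F L & Lmodule_isLieAlgebra F L}.

Notation "[Lie x , y ]" := (lie_bracket x y) : ring_scope.

Definition lie_subalgebra (F : fieldType) (L : lieAlgType F) (A : set L) : Prop :=
  [/\ A 0,
      forall (a : F) x y, A x -> A y -> A (a *: x + y) &
      forall x y, A x -> A y -> A [Lie x, y]].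

Definition lie_generated (F : fieldType) (L : lieAlgType F) (G : set L) : set L :=
  smallest (@lie_subalgebra F L) G.

Section GeneralLinear.
Variables (F : fieldType) (n : nat).

Definition gl := 'M[F]_n.
HB.instance Definition _ := GRing.Lmodule.copy gl 'M[F]_n.

Definition gl_bracket (A B : gl) : gl := A *m B - B *m A.

Fact gl_linearl (B : gl) : linear (fun A => gl_bracket A B).
Proof.
move=> a A1 A2; rewrite /gl_bracket mulmxDl mulmxDr -scalemxAl -scalemxAr.
by rewrite scalerBr opprD addrACA.
Qed.

Fact gl_linearr (A : gl) : linear (fun B => gl_bracket A B).
Proof.
move=> a B1 B2; rewrite /gl_bracket mulmxDl mulmxDr -scalemxAl -scalemxAr.
by rewrite scalerBr opprD addrACA.
Qed.

Fact gl_alternating (A : gl) : gl_bracket A A = 0.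
Proof. exact: subrr. Qed.

Fact gl_jacobi (A B C : gl) :
  gl_bracket A (gl_bracket B C) + gl_bracket B (gl_bracket C A)
    + gl_bracket C (gl_bracket A B) = 0.
Proof.
rewrite /gl_bracket !mulmxBr !mulmxBl !mulmxA !opprB.
move: (A *m B *m C) (A *m C *m B) (B *m C *m A) (C *m B *m A) (B *m A *m C)
  (C *m A *m B) => a b c d e f.
by apply/matrixP => i j; rewrite !mxE; ring.
Qed.

HB.instance Definition _ := Lmodule_isLieAlgebra.Build F gl
  gl_linearl gl_linearr gl_alternating gl_jacobi.

End GeneralLinear.

Inductive lie_term (F X : Type) : Type :=
  | LGen of X
  | LZero
  | LAdd of lie_term F X & lie_term F X
  | LScale of F & lie_term F X
  | LBracket of lie_term F X & lie_term F X.
Arguments LZero {F X}.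
Arguments LGen {F X} _.

HB.instance Definition _ (F X : Type) := gen_eqMixin (lie_term F X).
HB.instance Definition _ (F X : Type) := gen_choiceMixin (lie_term F X).

Section Presentation.
Variables (F : fieldType) (X : Type).
Variable rel : lie_term F X -> lie_term F X -> Prop.

(* The smallest congruence on terms which contains the Lie algebra axioms and
   the relations s = t for rel s t. *)
Inductive lie_cong : lie_term F X -> lie_term F X -> Prop :=
  | lc_rel s t : rel s t -> lie_cong s t
  | lc_refl s : lie_cong s s
  | lc_sym s t : lie_cong s t -> lie_cong t s
  | lc_trans s t u : lie_cong s t -> lie_cong t u -> lie_cong s u
  | lc_add s s' t t' :
      lie_cong s s' -> lie_cong t t' -> lie_cong (LAdd s t) (LAdd s' t')
  | lc_scale a s s' : lie_cong s s' -> lie_cong (LScale a s) (LScale a s')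
  | lc_bracket s s' t t' : lie_cong s s' -> lie_cong t t' ->
      lie_cong (LBracket s t) (LBracket s' t')
  | lc_addA s t u : lie_cong (LAdd s (LAdd t u)) (LAdd (LAdd s t) u)
  | lc_addC s t : lie_cong (LAdd s t) (LAdd t s)
  | lc_add0 s : lie_cong (LAdd LZero s) s
  | lc_addN s : lie_cong (LAdd (LScale (-1) s) s) LZero
  | lc_scaleA a b s : lie_cong (LScale a (LScale b s)) (LScale (a * b) s)
  | lc_scale1 s : lie_cong (LScale 1 s) s
  | lc_scaleDr a s t :
      lie_cong (LScale a (LAdd s t)) (LAdd (LScale a s) (LScale a t))
  | lc_scaleDl a b s :
      lie_cong (LScale (a + b) s) (LAdd (LScale a s) (LScale b s))
  | lc_linearl a s t u : lie_cong (LBracket (LAdd (LScale a s) t) u)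
      (LAdd (LScale a (LBracket s u)) (LBracket t u))
  | lc_linearr a s t u : lie_cong (LBracket u (LAdd (LScale a s) t))
      (LAdd (LScale a (LBracket u s)) (LBracket u t))
  | lc_alternating s : lie_cong (LBracket s s) LZero
  | lc_jacobi s t u : lie_cong
      (LAdd (LAdd (LBracket s (LBracket t u)) (LBracket t (LBracket u s)))
            (LBracket u (LBracket s t))) LZero.

Definition lie_congb s t := `[< lie_cong s t >].

Fact lie_congb_refl : reflexive lie_congb.
Proof. by move=> s; apply/asboolP/lc_refl. Qed.
Fact lie_congb_sym : symmetric lie_congb.
Proof. by move=> s t; apply/asboolP/asboolP; exact: lc_sym. Qed.
Fact lie_congb_trans : transitive lie_congb.
Proof. by move=> t s u /asboolP st /asboolP tu; apply/asboolP/(lc_trans st tu). Qed.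

Canonical lie_congb_equiv :=
  EquivRel lie_congb lie_congb_refl lie_congb_sym lie_congb_trans.

(* The Lie algebra presented by the generators X and the relations rel. *)
Definition presented := {eq_quot lie_congb}.
HB.instance Definition _ := Choice.on presented.

Definition pclass (s : lie_term F X) : presented := \pi_({eq_quot lie_congb}) s.
Definition prepr (x : presented) : lie_term F X := repr x.
Definition pgen (x : X) : presented := pclass (LGen x).

Lemma pclassP s t : pclass s = pclass t <-> lie_cong s t.
Proof.
split=> [/eqmodP/asboolP //|st]; by apply/eqmodP/asboolP.
Qed.

Lemma preprK x : pclass (prepr x) = x.
Proof. exact: reprK. Qed.

Lemma pclassK s : lie_cong (prepr (pclass s)) s.
Proof. by apply/pclassP; rewrite preprK. Qed.

Definition padd (x y : presented) := pclass (LAdd (prepr x) (prepr y)).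
Definition pscale a (x : presented) := pclass (LScale a (prepr x)).
Definition pbracket (x y : presented) := pclass (LBracket (prepr x) (prepr y)).

Lemma paddE s t : padd (pclass s) (pclass t) = pclass (LAdd s t).
Proof. by apply/pclassP/lc_add; exact: pclassK. Qed.
Lemma pscaleE a s : pscale a (pclass s) = pclass (LScale a s).
Proof. by apply/pclassP/lc_scale; exact: pclassK. Qed.
Lemma pbracketE s t : pbracket (pclass s) (pclass t) = pclass (LBracket s t).
Proof. by apply/pclassP/lc_bracket; exact: pclassK. Qed.

Let pE := (paddE, pscaleE, pbracketE).

Fact paddA : associative padd.
Proof.
move=> x y z; rewrite -[x]preprK -[y]preprK -[z]preprK !pE.
exact/pclassP/lc_addA.
Qed.
Fact paddC : commutative padd.
Proof. move=> x y; exact/pclassP/lc_addC. Qed.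
Fact padd0 : left_id (pclass LZero) padd.
Proof. by move=> x; rewrite -[x]preprK !pE; apply/pclassP/lc_add0. Qed.
Fact paddN : left_inverse (pclass LZero) (pscale (-1)) padd.
Proof. by move=> x; rewrite -[x]preprK !pE; apply/pclassP/lc_addN. Qed.

HB.instance Definition _ := GRing.isZmodule.Build presented
  paddA paddC padd0 paddN.

Fact pscaleA a b x : pscale a (pscale b x) = pscale (a * b) x.
Proof. by rewrite -[x]preprK !pE; apply/pclassP/lc_scaleA. Qed.
Fact pscale1 : left_id 1 pscale.
Proof. by move=> x; rewrite -[x]preprK !pE; apply/pclassP/lc_scale1. Qed.
Fact pscaleDr : right_distributive pscale +%R.
Proof.
move=> a x y; rewrite -[x]preprK -[y]preprK /GRing.add /= !pE.
exact/pclassP/lc_scaleDr.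
Qed.
Fact pscaleDl x : {morph pscale^~ x : a b / a + b}.
Proof.
move=> a b; rewrite -[x]preprK -[RHS]/(padd _ _) !pE.
exact/pclassP/lc_scaleDl.
Qed.

HB.instance Definition _ := GRing.Zmodule_isLmodule.Build F presented
  pscaleA pscale1 pscaleDr pscaleDl.

Fact plinearl (y : presented) : linear (fun x => pbracket x y).
Proof.
move=> a x1 x2; rewrite -[x1]preprK -[x2]preprK -[y]preprK.
rewrite -[RHS]/(padd (pscale a _) _) -[a *: _ + _]/(padd (pscale a _) _) !pE.
exact/pclassP/lc_linearl.
Qed.
Fact plinearr (x : presented) : linear (fun y => pbracket x y).
Proof.
move=> a y1 y2; rewrite -[y1]preprK -[y2]preprK -[x]preprK.
rewrite -[RHS]/(padd (pscale a _) _) -[a *: _ + _]/(padd (pscale a _) _) !pE.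
exact/pclassP/lc_linearr.
Qed.
Fact palternating (x : presented) : pbracket x x = 0.
Proof. by rewrite -[x]preprK !pE; apply/pclassP/lc_alternating. Qed.
Fact pjacobi (x y z : presented) :
  pbracket x (pbracket y z) + pbracket y (pbracket z x)
    + pbracket z (pbracket x y) = 0.
Proof.
rewrite -[LHS]/(padd (padd _ _) _) -[x]preprK -[y]preprK -[z]preprK !pE.
exact/pclassP/lc_jacobi.
Qed.

HB.instance Definition _ := Lmodule_isLieAlgebra.Build F presented
  plinearl plinearr palternating pjacobi.

Section UniversalProperty.
Variables (L : lieAlgType F) (f : X -> L).

Fixpoint lie_eval (s : lie_term F X) : L :=
  match s with
  | LGen x => f x
  | LZero => 0
  | LAdd s t => lie_eval s + lie_eval t
  | LScale a s => a *: lie_eval s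
  | LBracket s t => [Lie lie_eval s, lie_eval t]
  end.

Hypothesis frel : forall s t, rel s t -> lie_eval s = lie_eval t.

Lemma lie_eval_cong s t : lie_cong s t -> lie_eval s = lie_eval t.
Proof.
elim=> //= {s t}.
- by move=> s t u _ -> _ ->.
- by move=> s s' t t' _ -> _ ->.
- by move=> a s s' _ ->.
- by move=> s s' t t' _ -> _ ->.
- by move=> s t u; rewrite addrA.
- by move=> s t; rewrite addrC.
- by move=> s; rewrite add0r.
- by move=> s; rewrite scaleN1r addNr.
- by move=> a b s; rewrite scalerA.
- by move=> s; rewrite scale1r.
- by move=> a s t; rewrite scalerDr.
- by move=> a b s; rewrite scalerDl.
- by move=> a s t u; rewrite lie_linearl.
- by move=> a s t u; rewrite lie_linearr.
- by move=> s; rewrite lie_alternating.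
- by move=> s t u; rewrite lie_jacobi.
Qed.

Definition presented_lift (x : presented) : L := lie_eval (prepr x).

Lemma presented_liftE s : presented_lift (pclass s) = lie_eval s.
Proof. exact/lie_eval_cong/pclassK. Qed.

Lemma presented_lift_linear : linear presented_lift.
Proof.
move=> a x y; rewrite -[x]preprK -[y]preprK.
by rewrite -[a *: _ + _]/(padd (pscale a _) _) !pE !presented_liftE.
Qed.

Lemma presented_lift_bracket :
  {morph presented_lift : x y / [Lie x, y] >-> [Lie x, y]}.
Proof.
move=> x y; rewrite -[x]preprK -[y]preprK.
by rewrite -[lie_bracket (pclass _) _]/(pbracket _ _) !pE !presented_liftE.
Qed.

Lemma presented_lift_gen x : presented_lift (pgen x) = f x.
Proof. exact: presented_liftE. Qed.

End UniversalProperty.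
End Presentation.

(* An index j : 'I_r stands for the index j + 1 of the usual 1-based numbering,
   so that the last generator is the one with j.+1 = r. *)
Section Generators.
Variables (R : realType) (r : nat).

Definition glK (j : 'I_r) : gl R[i] r :=
  if insub j.+1 is Some k then delta_mx j k - delta_mx k j
  else 'i%C *: delta_mx j j.

Lemma glK_lt (j k : 'I_r) : k = j.+1 :> nat -> glK j = delta_mx j k - delta_mx k j.
Proof. by move=> kj; rewrite /glK -kj valK. Qed.

Lemma glK_lastE (j : 'I_r) : j.+1 = r -> glK j = 'i%C *: delta_mx j j.
Proof. by move=> jr; rewrite /glK insubF // jr ltnn. Qed.

Definition glZ : gl R[i] r := \sum_(l < r) delta_mx l l.

Local Notation x := (@LGen R[i] 'I_r).
Local Notation "[tm s , t ]" := (@LBracket R[i] 'I_r s t)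
  (at level 0, s, t at level 99).

Inductive glK_rel : lie_term R[i] 'I_r -> lie_term R[i] 'I_r -> Prop :=
  | glK_far (j k : 'I_r) : (1 < `|j - k|)%N ->
      glK_rel [tm x j, x k] LZero
  | glK_up (j k : 'I_r) : k = j.+1 :> nat -> (k.+1 < r)%N ->
      glK_rel [tm x j, [tm x j, x k]] (LScale (-1) (x k))
  | glK_down (j k : 'I_r) : k = j.+1 :> nat ->
      glK_rel [tm x k, [tm x k, x j]] (LScale (-1) (x j))
  | glK_last (j k : 'I_r) : k = j.+1 :> nat -> k.+1 = r ->
      glK_rel [tm x j, [tm x j, [tm x j, x k]]] (LScale (-4) [tm x j, x k]).

End Generators.

(* Main.v *)
From HB Require Import structures.
Require Import Defs.
From mathcomp Require Import all_boot all_order all_algebra zify ring.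
From mathcomp Require Import boolp classical_sets reals.
From mathcomp.real_closed Require Import complex.

Set Implicit Arguments.
Unset Strict Implicit.
Unset Printing Implicit Defensive.

Import GRing.Theory Num.Theory.
Local Open Scope ring_scope.

(* The relations let one build, inside any Lie algebra that satisfies them,
   r^2 elements A_jk, S_jk (j < k) and T_j which play the parts of
   E_jk - E_kj, i(E_jk + E_kj) and iE_jj: put A_{j,k+1} = [A_jk, K_k],
   T_r = K_r, T_j = T_{j+1} + 1/2 [K_j, [K_j, T_{j+1}]] and S_jk = [A_jk, T_k].
   The relations imply that bracketing with any K_m maps these elements into
   their span.  In the presented algebra this span is therefore everything, so
   the surjection onto gl_r, which sends the r^2 elements to a basis, is
   bijective. *)

(** * Consequences of the relations for a few elements of a Lie algebra *)

Section LieIdentities.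
Variables (F : numFieldType) (L : lieAlgType F).
Implicit Types (a b c u x y z : L).

Lemma lieDl x y z : [Lie x + y, z] = [Lie x, z] + [Lie y, z].
Proof. by have := lie_linearl z 1 x y; rewrite !scale1r. Qed.

Lemma lieDr x y z : [Lie z, x + y] = [Lie z, x] + [Lie z, y].
Proof. by have := lie_linearr z 1 x y; rewrite !scale1r. Qed.

Lemma lie0l x : [Lie 0, x] = 0.
Proof. by apply: (addrI [Lie 0, x]); rewrite -lieDl !addr0. Qed.

Lemma lie0r x : [Lie x, 0] = 0.
Proof. by apply: (addrI [Lie x, 0]); rewrite -lieDr !addr0. Qed.

Lemma lieZl (t : F) x y : [Lie t *: x, y] = t *: [Lie x, y].
Proof. by have := lie_linearl y t x 0; rewrite !addr0 lie0l addr0. Qed.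

Lemma lieZr (t : F) x y : [Lie y, t *: x] = t *: [Lie y, x].
Proof. by have := lie_linearr y t x 0; rewrite !addr0 lie0r addr0. Qed.

Lemma lieNl x y : [Lie - x, y] = - [Lie x, y].
Proof. by rewrite -scaleN1r lieZl scaleN1r. Qed.

Lemma lieNr x y : [Lie y, - x] = - [Lie y, x].
Proof. by rewrite -scaleN1r lieZr scaleN1r. Qed.

Lemma lieC x y : [Lie x, y] = - [Lie y, x].
Proof.
apply/eqP; rewrite -addr_eq0; have := lie_alternating (x + y).
by rewrite lieDl !lieDr !lie_alternating add0r addr0 => ->.
Qed.

Lemma lieJ x y z : [Lie x, [Lie y, z]] = [Lie [Lie x, y], z] + [Lie y, [Lie x, z]].
Proof.
have /eqP := lie_jacobi x y z; rewrite -addrA addr_eq0 => /eqP ->.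
by rewrite (lieC z [Lie x, y]) (lieC z x) lieNr opprD !opprK addrC.
Qed.

Lemma lieJl x y z : [Lie [Lie x, y], z] = [Lie x, [Lie y, z]] - [Lie y, [Lie x, z]].
Proof. by rewrite lieJ addrK. Qed.

Lemma lie_comm x y : [Lie x, y] = 0 -> [Lie y, x] = 0.
Proof. by rewrite lieC => /eqP; rewrite oppr_eq0 => /eqP. Qed.

Lemma lie_bracket_comm x y z :
  [Lie x, y] = 0 -> [Lie x, z] = 0 -> [Lie x, [Lie y, z]] = 0.
Proof. by move=> xy xz; rewrite lieJ xy xz lie0l lie0r addr0. Qed.

Lemma lie_self_opp x : x = - x -> x = 0.
Proof.
move/eqP; rewrite -addr_eq0 -mulr2n -scaler_nat scaler_eq0 pnatr_eq0 /=.
by move/eqP.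
Qed.

(** Used with a, b, c = A_jm, K_m, K_{m+1} to show that K_m commutes with A_{j,m+2}. Expanding [a,
    [b, [b, c]]] = - [a, c] = 0 by the Jacobi identity gives twice the bracket in question, and 2 is
    invertible. *)
Lemma lie_middle a b c : [Lie a, c] = 0 ->
    [Lie b, [Lie b, a]] = - a -> [Lie b, [Lie b, c]] = - c ->
  [Lie b, [Lie [Lie a, b], c]] = 0.
Proof.
move=> ac bba bbc; have bab : [Lie b, [Lie a, b]] = a by rewrite (lieC a) lieNr bba opprK.
have E : [Lie b, [Lie [Lie a, b], c]] = [Lie [Lie a, b], [Lie b, c]].
  by rewrite lieJ bab ac add0r.
have abc : [Lie a, [Lie b, c]] = [Lie [Lie a, b], c] by rewrite lieJ ac lie0r addr0.
have := lieJ a b [Lie b, c]; rewrite bbc lieNr ac oppr0 abc -E => /esym/eqP.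
by rewrite addr_eq0 => /eqP; exact: lie_self_opp.
Qed.

(** The hypothesis read in the adjoint action: ad_x^2 ad_y - 2 ad_x ad_y ad_x + ad_y ad_x^2 = -
    ad_y, applied to z. *)
Lemma lie_serre x y z : [Lie x, [Lie x, y]] = - y ->
  [Lie x, [Lie x, [Lie y, z]]] + [Lie y, [Lie x, [Lie x, z]]] + [Lie y, z]
   = 2 *: [Lie x, [Lie y, [Lie x, z]]].
Proof.
move=> xxy; have : [Lie [Lie x, [Lie x, y]], z] = - [Lie y, z] by rewrite xxy lieNl.
rewrite !lieJl !lieDr !lieNr.
set p := [Lie x, [Lie x, _]]; set q := [Lie x, [Lie y, _]]; set w := [Lie y, [Lie x, _]].
rewrite opprB => E; rewrite -[[Lie y, z]]opprK -E scaler_nat mulr2n.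
by rewrite opprD !opprB [X in _ + X]addrACA -opprD [LHS]addrC subrK.
Qed.

(* Three consecutive elements of the construction: a, b, u are K_j, K_{j+1} and
   T_{j+2}, and v below is T_{j+1}. *)
Section RankTwo.
Variables (a b u : L).
Hypotheses (aab : [Lie a, [Lie a, b]] = - b) (bba : [Lie b, [Lie b, a]] = - a).
Hypotheses (au : [Lie a, u] = 0).
Hypothesis bbbu : [Lie b, [Lie b, [Lie b, u]]] = -4 *: [Lie b, u].

Lemma lie_abbu : [Lie a, [Lie b, [Lie b, u]]] = 2 *: [Lie b, [Lie a, [Lie b, u]]].
Proof.
by have := lie_serre u bba; rewrite au !lie0r add0r addr0.
Qed.

Lemma lie_aabu : [Lie a, [Lie a, [Lie b, u]]] = - [Lie b, u].
Proof.
have := lie_serre u aab; rewrite au !lie0r scaler0 addr0.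
by move/eqP; rewrite addr_eq0 => /eqP.
Qed.

(** With x the left side and y = [a, [b, u]], [lie_serre] at [b, u] reads x - 4 y + y = 4 x, so 3 x
    = - 3 y. *)
Lemma lie_bbabu : [Lie b, [Lie b, [Lie a, [Lie b, u]]]] = - [Lie a, [Lie b, u]].
Proof.
have := lie_serre [Lie b, u] bba; rewrite lie_abbu bbbu !lieZr.
set x := [Lie b, [Lie b, _]]; set y := [Lie a, _].
rewrite scalerA -{2}[y]scale1r -addrA -scalerDl -{1}[x]scale1r => /eqP.
rewrite addrC eq_sym -subr_eq -scalerBl => /eqP.
have -> : 2 * 2 - 1 = - (-4 + 1) :> F by ring.
rewrite scaleNr -scalerN => /scalerI E; rewrite -[LHS]opprK -E ?opprK //.
have -> : -4 + 1 = - 3%:R :> F by ring.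
by rewrite oppr_eq0 pnatr_eq0.
Qed.

(** Put w = [a, [b, u]]. In [lie_serre] at w the terms [b, [a, [a, w]]] and [b, w] cancel, which
    leaves 2 [a, [b, [a, w]]] = - 2 [a, [b, [b, u]]]. *)
Lemma lie_aababu :
  [Lie a, [Lie a, [Lie b, [Lie a, [Lie b, u]]]]] = -4 *: [Lie b, [Lie a, [Lie b, u]]].
Proof.
have := lie_serre [Lie a, [Lie b, u]] aab.
rewrite lie_aabu !lieNr lie_abbu subrK scalerN scalerA -scaleNr.
by have -> : - (2 * 2) = -4 :> F by ring.
Qed.

Lemma lie_bababu :
  [Lie b, [Lie a, [Lie b, [Lie a, [Lie b, u]]]]] = 2 *: [Lie b, u].
Proof.
have := lie_serre [Lie a, [Lie b, u]] bba.
rewrite lie_bbabu lie_aabu !lieNr lie_aabu opprK addrK bbbu -scaleNr => /esym E.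
apply: (@scalerI _ _ 2); first by rewrite pnatr_eq0.
by rewrite E scalerA; congr (_ *: _); ring.
Qed.

Local Notation v := (u + 2^-1 *: [Lie b, [Lie b, u]]).

Lemma lie_av : [Lie a, v] = [Lie b, [Lie a, [Lie b, u]]].
Proof.
by rewrite lieDr au add0r lieZr lie_abbu scalerA mulVf ?scale1r// pnatr_eq0.
Qed.

Lemma lie_last : [Lie a, [Lie a, [Lie a, v]]] = -4 *: [Lie a, v].
Proof. by rewrite lie_av lie_aababu. Qed.

Lemma lie_bv : [Lie b, v] = - [Lie b, u].
Proof.
rewrite lieDr lieZr bbbu scalerA -{1}[[Lie b, u]]scale1r -scalerDl -scaleN1r.
by congr (_ *: _); field.
Qed.

(** The second argument is T_j. Bracketing b with its two summands gives - [b, u] and [b, u]. *)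
Lemma lie_bw : [Lie b, v + 2^-1 *: [Lie a, [Lie a, v]]] = 0.
Proof.
by rewrite lieDr lie_bv lieZr lie_av lie_bababu scalerA mulVf ?scale1r ?addNr ?pnatr_eq0.
Qed.

(** Here [a, b] is A_{j,j+2}, so this is the shortest case of A_jk commuting with T_l for j < l <
    k. *)
Lemma lie_abv : [Lie [Lie a, b], v] = 0.
Proof.
apply: (addIr [Lie b, [Lie a, v]]); rewrite -lieJ lie_bv lie_av lie_bbabu.
by rewrite lieNr add0r.
Qed.

End RankTwo.
End LieIdentities.

Lemma downward_ind (n : nat) (P : nat -> Prop) : P n ->
  (forall j, (j < n)%N -> P j.+1 -> P j) -> forall j, (j <= n)%N -> P j.
Proof.
move=> Pn IH j jn; rewrite -(subKn jn); elim: (n - j)%N (leq_subr j n) => [|d IHd] dn.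
  by rewrite subn0.
by apply: IH; [lia | rewrite subnSK //; apply: IHd; lia].
Qed.

(** * Construction of the elements A, S and T from the generators *)

Section RootVectors.
Variables (F : numFieldType) (L : lieAlgType F) (K : nat -> L) (n : nat).

(* For K_j the generators of gl_r with indices starting at 0 and n = r - 1,
   lieA j k, lieT j and lieS j k are E_jk - E_kj, iE_jj and i(E_jk + E_kj);
   lieA j k = 0 is a junk value for k <= j. *)
Fixpoint lieA (j k : nat) : L :=
  if k is k'.+1 then if k' == j then K j else [Lie lieA j k', K k'] else 0.

(** The recursion for T runs downwards from n, so it is made structural in the distance d = n -
    j. *)
Fixpoint lieT_rec (d : nat) : L :=
  if d is d'.+1 then
    lieT_rec d' + 2^-1 *: [Lie K (n - d), [Lie K (n - d), lieT_rec d']]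
  else K n.

Definition lieT (j : nat) : L := lieT_rec (n - j).

Definition lieS (j k : nat) : L := [Lie lieA j k, lieT k].

Lemma lieA_gen j : lieA j j.+1 = K j.
Proof. by rewrite /= eqxx. Qed.

Lemma lieAS j k : (j < k)%N -> lieA j k.+1 = [Lie lieA j k, K k].
Proof. by move=> jk /=; case: eqP => // kj; lia. Qed.

Lemma lieT_last : lieT n = K n.
Proof. by rewrite /lieT subnn. Qed.

Lemma lieTS j : (j < n)%N ->
  lieT j = lieT j.+1 + 2^-1 *: [Lie K j, [Lie K j, lieT j.+1]].
Proof.
move=> jn; rewrite /lieT; have -> : (n - j = (n - j.+1).+1)%N by lia.
by rewrite /=; have -> : (n - (n - j.+1).+1 = j)%N by lia.
Qed.

Hypothesis Kfar : forall j k, (j.+1 < k)%N -> (k <= n)%N -> [Lie K j, K k] = 0.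
Hypothesis Kup : forall j, (j.+1 < n)%N -> [Lie K j, [Lie K j, K j.+1]] = - K j.+1.
Hypothesis Kdown : forall j, (j < n)%N -> [Lie K j.+1, [Lie K j.+1, K j]] = - K j.
Hypothesis Klast : forall j, j.+1 = n ->
  [Lie K j, [Lie K j, [Lie K j, K n]]] = -4 *: [Lie K j, K n].

(** * Brackets of the generators with A_jk *)

Lemma lieKA_above m j k : (j < k)%N -> (k < m)%N -> (m <= n)%N ->
  [Lie K m, lieA j k] = 0.
Proof.
elim: k => // k IH jk km mn; case: (ltngtP j k) => [jk'||->]; [|lia|].
  rewrite lieAS //; apply: lie_bracket_comm; first by apply: IH => //; lia.
  by apply/lie_comm/Kfar.
by rewrite lieA_gen; apply/lie_comm/Kfar.
Qed.

Lemma lieKA_below m j k : (m.+1 < j)%N -> (j < k)%N -> (k <= n)%N ->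
  [Lie K m, lieA j k] = 0.
Proof.
elim: k => // k IH mj jk kn; case: (ltngtP j k) => [jk'||jk']; [|lia|].
  rewrite lieAS //; apply: lie_bracket_comm; first by apply: IH => //; lia.
  by apply: Kfar; lia.
by rewrite -jk' lieA_gen; apply: Kfar; lia.
Qed.

(** By definition A_jk grows at its right end; since K_j commutes with the generators added there,
    it can also be grown at its left end. *)
Lemma lieA_cons j k : (j.+1 < k)%N -> (k <= n)%N ->
  [Lie K j, lieA j.+1 k] = lieA j k.
Proof.
elim: k => // k IH jk kn; case: (ltngtP j.+1 k) => [jk'||jk']; [|lia|].
  have jKk : [Lie K j, K k] = 0 by apply: Kfar; lia.
  rewrite lieAS // lieJ jKk lie0r addr0 IH; [|lia..].
  by rewrite lieAS //; lia.
by rewrite -jk' lieA_gen lieAS // lieA_gen.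
Qed.

(** For j < k - 1, A_{j,k+1} = [A_{j,k-1}, [K_{k-1}, K_k]], and K_k commutes with A_{j,k-1}, so it
    acts on the inner bracket alone, where [Kdown] applies. *)
Lemma lieKA_end j k : (j < k)%N -> (k < n)%N ->
  [Lie K k, lieA j k.+1] = lieA j k.
Proof.
case: k => // k jk kn; rewrite lieAS //; case: (ltngtP j k) => [jk'||->]; [|lia|].
  have yK : [Lie lieA j k, K k.+1] = 0 by apply/lie_comm/lieKA_above; lia.
  rewrite [lieA j k.+1]lieAS //.
  have -> : [Lie [Lie lieA j k, K k], K k.+1] = [Lie lieA j k, [Lie K k, K k.+1]].
    by rewrite lieJ yK lie0r addr0.
  have KY : [Lie K k.+1, lieA j k] = 0 by apply/lie_comm.
  by rewrite lieJ KY lie0l add0r [X in [Lie _, [Lie _, X]]]lieC lieNr Kdown ?opprK //; lia.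
by rewrite lieA_gen [X in [Lie _, X]]lieC lieNr Kdown ?opprK //; lia.
Qed.

Lemma lieKA_start j k : (j.+1 < k)%N -> (k <= n)%N ->
  [Lie K j, lieA j k] = - lieA j.+1 k.
Proof.
elim: k => // k IH jk kn; case: (ltngtP j.+1 k) => [jk'||jk']; [|lia|].
  have jKk : [Lie K j, K k] = 0 by apply: Kfar; lia.
  rewrite lieAS; last lia; rewrite lieJ jKk lie0r addr0 IH; [|lia..].
  by rewrite lieNl lieAS.
by rewrite -jk' lieA_gen lieAS // lieA_gen Kup //; lia.
Qed.

Lemma lieKA_inside m j k : (j < m)%N -> (m.+1 < k)%N -> (k <= n)%N ->
  [Lie K m, lieA j k] = 0.
Proof.
elim: k => // k IH jm mk kn; case: (ltngtP m.+1 k) => [mk'||mk']; [|lia|].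
  rewrite lieAS; last lia; apply: lie_bracket_comm; first by apply: IH => //; lia.
  by apply: Kfar; lia.
rewrite -mk' lieAS; last lia; rewrite lieAS //; apply: lie_middle.
- by apply/lie_comm/lieKA_above; lia.
- by rewrite [X in [Lie _, X]]lieC -lieAS // lieNr lieKA_end //; lia.
- by apply: Kup; lia.
Qed.

(** * Brackets of the generators and of A_jk with T_l *)

Lemma lieKT_below m j : (m.+1 < j)%N -> (j <= n)%N -> [Lie K m, lieT j] = 0.
Proof.
move=> mj jn; move: mj; pattern j; apply: downward_ind jn => [mn|i ni IH mi].
  by rewrite lieT_last Kfar.
have Ki : [Lie K m, K i] = 0 by apply: Kfar; lia.
have Ti : [Lie K m, lieT i.+1] = 0 by apply: IH; lia.
by rewrite lieTS // lieDr lieZr Ti add0r !lie_bracket_comm ?scaler0.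
Qed.

(** The relation [Klast] is the case j + 1 = n. For smaller j, [lie_last] derives it from the
    quadratic relations and [K_j, T_{j+2}] = 0. *)
Lemma lieKT_cube j : (j < n)%N ->
  [Lie K j, [Lie K j, [Lie K j, lieT j.+1]]] = -4 *: [Lie K j, lieT j.+1].
Proof.
move=> jn; case: (ltngtP j.+1 n) => [jn'||jn']; [|lia|].
  by rewrite (lieTS jn'); apply: lie_last; [exact: Kup | exact: Kdown | exact: lieKT_below].
by rewrite jn' lieT_last Klast.
Qed.

Lemma lieKT_start j : (j < n)%N -> [Lie K j, lieT j] = - [Lie K j, lieT j.+1].
Proof. by move=> jn; rewrite lieTS //; apply: lie_bv; rewrite lieKT_cube. Qed.

Lemma lieKT_above m j : (j < m)%N -> (m <= n)%N -> [Lie K m, lieT j] = 0.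
Proof.
move=> jm mn; have jn : (j <= n)%N by lia.
move: jm; pattern j; apply: downward_ind jn => [|i ni IH im]; first lia.
case: (ltngtP i.+1 m) => [im'||im']; [|lia|].
  have Ki : [Lie K m, K i] = 0 by apply/lie_comm/Kfar.
  by rewrite lieTS // lieDr lieZr IH // add0r !lie_bracket_comm ?scaler0 ?IH.
case: (ltngtP m n) => [mn'||mn']; [|lia|].
  (* With m = i + 1 < n, unfolding T_i and T_m down to T_{m+1} gives the configuration of [lie_bw]
     for a, b, u = K_i, K_m, T_{m+1}. *)
  rewrite lieTS // im' (lieTS mn'); apply: lie_bw.
  - by rewrite -im'; apply: Kup; lia.
  - by rewrite -im'; apply: Kdown.
  - by apply: lieKT_below; lia.
  - exact: lieKT_cube.
(* Here m = n = i + 1 and T_n = K_n. Since [K_n, [K_i, K_n]] = K_i, both Jacobi terms of [K_n, [K_i,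
   [K_i, K_n]]] are brackets of an element with a multiple of itself. *)
rewrite lieTS // im' mn' lieT_last lieDr lie_alternating add0r lieZr.
have E : [Lie K n, [Lie K i, K n]] = K i.
  by rewrite [X in [Lie _, X]]lieC lieNr -mn' -im' Kdown ?opprK.
by rewrite lieJ E lie_alternating addr0 (lieC (K n)) lieNl lie_alternating oppr0 scaler0.
Qed.

Lemma lieAT j k l : (j < k)%N -> (k <= n)%N -> (l <= n)%N -> l != j -> l != k ->
  [Lie lieA j k, lieT l] = 0.
Proof.
move=> jk kn ln lj lk.
have comm_last (x y z : L) : [Lie z, x] = 0 -> [Lie z, y] = 0 -> [Lie [Lie x, y], z] = 0.
  by move=> zx zy; apply/lie_comm/lie_bracket_comm.
have [klt|lek] := ltnP k l.
  elim: k jk kn lk klt => // k IH jk kn lk kl; case: (ltngtP j k) => [jk'||->]; [|lia|].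
    rewrite lieAS //; apply: comm_last; apply: lie_comm; first by apply: IH; lia.
    exact: lieKT_below.
  by rewrite lieA_gen lieKT_below.
have [llj|lej] := ltnP l j.
  elim: k jk kn {lk lek} => // k IH jk kn; case: (ltngtP j k) => [jk'||jk']; [|lia|].
    rewrite lieAS //; apply: comm_last; apply: lie_comm; first by apply: IH; lia.
    by apply: lieKT_above; lia.
  by rewrite -jk' lieA_gen; apply: lieKT_above; lia.
(* For j < l < k, stripping generators from the right end reduces to k = l + 1, and then stripping
   them from the left end reduces to j = l - 1, which is [lie_abv]. *)
have {lej lek lj lk} [jl {}lk] : (j < l /\ l < k)%N by lia.
elim: k jk kn lk => // k IH jk kn lk; case: (ltngtP l k) => [lk'||<-]; [|lia|].
  rewrite lieAS; last lia.
  apply: comm_last; apply: lie_comm; first by apply: IH; lia.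
  by apply: lieKT_above; lia.
have {k IH jk lk kn} kn : (l < n)%N by lia.
case: l ln jl kn => // l ln; rewrite ltnS => jl kn; move: j jl; apply: downward_ind.
  rewrite lieAS // lieA_gen (lieTS kn); apply: lie_abv.
  - by apply: Kdown; lia.
  - by apply: lieKT_below; lia.
  - exact: lieKT_cube.
move=> i il IH; rewrite -lieA_cons; [|lia..].
apply: comm_last; apply: lie_comm; last exact: IH.
by apply: lieKT_below; lia.
Qed.

(** * Brackets of the generators with S_jk *)

Lemma lieS_gen j : lieS j j.+1 = [Lie K j, lieT j.+1].
Proof. by rewrite /lieS lieA_gen. Qed.

Lemma lieKS_before j k : (j.+1 < k)%N -> (k <= n)%N -> [Lie K j, lieS j.+1 k] = lieS j k.
Proof. by move=> jk kn; rewrite /lieS lieJ lieA_cons // lieKT_below // lie0r addr0. Qed.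

Lemma lieKS_start j k : (j.+1 < k)%N -> (k <= n)%N ->
  [Lie K j, lieS j k] = - lieS j.+1 k.
Proof.
by move=> jk kn; rewrite /lieS lieJ lieKA_start // lieKT_below // lie0r addr0 lieNl.
Qed.

Lemma lieKS_gen j : (j < n)%N -> [Lie K j, lieS j j.+1] = 2 *: (lieT j - lieT j.+1).
Proof.
move=> jn; rewrite lieS_gen (lieTS jn) addrAC subrr add0r scalerA.
by rewrite mulfV ?scale1r // pnatr_eq0.
Qed.

Lemma lieKS_after j k : (j < k)%N -> (k < n)%N -> [Lie K k, lieS j k] = - lieS j k.+1.
Proof.
move=> jk kn; have AkT : [Lie lieA j k, lieT k.+1] = 0 by apply: lieAT; lia.
rewrite /lieS lieJ (lieC (K k) (lieA j k)) -lieAS // lieKT_start // lieNl lieAT; [|lia..].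
by rewrite oppr0 add0r lieNr lieJ AkT lie0r addr0 -lieAS.
Qed.

(** As A_jk commutes with T_{k+1}, expanding T_k in S_jk leaves half of [A_jk, [K_k,
    [K_k, T_{k+1}]]]. The Jacobi identity splits this bracket into two terms, each equal to
    [K_k, S_{j,k+1}]. *)
Lemma lieKS_end j k : (j < k)%N -> (k < n)%N -> [Lie K k, lieS j k.+1] = lieS j k.
Proof.
move=> jk kn; have AkT : [Lie lieA j k, lieT k.+1] = 0 by apply: lieAT; lia.
have AKT : [Lie lieA j k, [Lie K k, lieT k.+1]] = lieS j k.+1.
  by rewrite lieJ AkT lie0r addr0 -lieAS.
have -> : lieS j k = 2^-1 *: [Lie lieA j k, [Lie K k, [Lie K k, lieT k.+1]]].
  by rewrite {1}/lieS (lieTS kn) lieDr lieZr AkT add0r.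
have E : [Lie lieA j k.+1, [Lie K k, lieT k.+1]] = [Lie K k, lieS j k.+1].
  by rewrite lieJ (lieC _ (K k)) lieKA_end // lieNl AkT oppr0 add0r.
rewrite lieJ -lieAS // AKT E -mulr2n -scaler_nat scalerA mulVf ?scale1r //.
by rewrite pnatr_eq0.
Qed.

(** For j < n - 1, K_n commutes with A_{j,n-1}, so in A_jn = [A_{j,n-1}, K_{n-1}] it acts on K_{n-1}
    alone, by [Kdown]. *)
Lemma lieKnA j : (j < n)%N -> [Lie K n, [Lie K n, lieA j n]] = - lieA j n.
Proof.
move=> jn; have [k kn] : exists k, n = k.+1 by exists n.-1; lia.
have kd : [Lie K n, [Lie K n, K k]] = - K k by rewrite kn; apply: Kdown; lia.
case: (ltngtP j k) => [jk||->]; [|lia|]; last first.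
  by have -> : lieA k n = K k by rewrite kn lieA_gen.
have -> : lieA j n = [Lie lieA j k, K k] by rewrite kn lieAS.
have nA : [Lie K n, lieA j k] = 0 by apply: lieKA_above; lia.
by do 2! rewrite (lieJ _ (lieA j k)) nA lie0l add0r; rewrite kd lieNr.
Qed.

Lemma lieKnS j : (j < n)%N -> [Lie K n, lieS j n] = lieA j n.
Proof. by move=> jn; rewrite /lieS lieT_last (lieC (lieA j n)) lieNr lieKnA ?opprK. Qed.

(** * Stability of the span of A, S and T under the generators *)

Section Span.
Variable W : L -> Prop.
Hypothesis W0 : W 0.
Hypothesis WD : forall a x y, W x -> W y -> W (a *: x + y).
Hypothesis WA : forall j k, (j < k)%N -> (k <= n)%N -> W (lieA j k).
Hypothesis WS : forall j k, (j < k)%N -> (k <= n)%N -> W (lieS j k).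
Hypothesis WT : forall j, (j <= n)%N -> W (lieT j).

Let WZ a x : W x -> W (a *: x).
Proof. by move=> Wx; rewrite -[_ *: _]addr0; exact: WD. Qed.

Let WN x : W x -> W (- x).
Proof. by rewrite -scaleN1r; exact: WZ. Qed.

Lemma span_lieKA m j k : (m <= n)%N -> (j < k)%N -> (k <= n)%N -> W [Lie K m, lieA j k].
Proof.
move=> mn jk kn; case: (ltngtP m k) => [mk|mk|mk]; last first.
- case: (ltngtP k n) => [kn'||kn']; [|lia|].
    by rewrite mk lieC -lieAS //; apply/WN/WA => //; lia.
  by rewrite mk kn' -lieT_last lieC; apply/WN/WS; lia.
- by rewrite lieKA_above.
case: (ltngtP m.+1 k) => [mk'||mk']; [|lia|].
  case: (ltngtP m j) => [mj|mj|->].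
  - case: (ltngtP m.+1 j) => [mj'||mj']; [|lia|].
      by rewrite lieKA_below.
    by rewrite -mj' lieA_cons //; apply: WA; lia.
  - by rewrite lieKA_inside.
  - case: (ltngtP j.+1 k) => [jk'||<-]; [|lia|].
      by rewrite lieKA_start //; apply/WN/WA.
    by rewrite lieA_gen lie_alternating.
case: (ltngtP j m) => [jm||->]; [|lia|].
  by rewrite -mk' lieKA_end //; [apply: WA|]; lia.
by rewrite -mk' lieA_gen lie_alternating.
Qed.

Lemma span_lieKS m j k : (m <= n)%N -> (j < k)%N -> (k <= n)%N -> W [Lie K m, lieS j k].
Proof.
move=> mn jk kn; case: (ltngtP m k) => [mk|mk|mk]; last first.
- case: (ltngtP k n) => [kn'||kn']; [|lia|].
    by rewrite mk lieKS_after //; apply/WN/WS => //; lia.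
  by rewrite mk kn' lieKnS; [apply: WA|]; lia.
- by rewrite /lieS lie_bracket_comm ?lieKA_above ?lieKT_above.
case: (ltngtP m.+1 k) => [mk'||mk']; [|lia|].
  have mT : [Lie K m, lieT k] = 0 by apply: lieKT_below.
  case: (ltngtP m j) => [mj|mj|->].
  - case: (ltngtP m.+1 j) => [mj'||mj']; [|lia|].
      by rewrite /lieS lie_bracket_comm ?lieKA_below.
    by rewrite -mj' lieKS_before //; apply: WS; lia.
  - by rewrite /lieS lie_bracket_comm ?lieKA_inside.
  - case: (ltngtP j.+1 k) => [jk'||<-]; [|lia|].
      by rewrite lieKS_start //; apply/WN/WS.
    by rewrite lieKS_gen; [apply/WZ; rewrite -scaleN1r addrC; apply: WD; apply: WT|]; lia.
case: (ltngtP j m) => [jm||->]; [|lia|].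
  by rewrite -mk' lieKS_end //; [apply: WS|]; lia.
by rewrite -mk' lieKS_gen; [apply/WZ; rewrite -scaleN1r addrC; apply: WD; apply: WT|]; lia.
Qed.

Lemma span_lieKT m j : (m <= n)%N -> (j <= n)%N -> W [Lie K m, lieT j].
Proof.
move=> mn jn; case: (ltngtP m j) => [mj|mj|->].
- case: (ltngtP m.+1 j) => [mj'||<-]; [|lia|].
    by rewrite lieKT_below.
  by rewrite -lieS_gen; apply: WS; lia.
- by rewrite lieKT_above.
case: (ltngtP j n) => [jn'||->]; [|lia|].
  by rewrite lieKT_start // -lieS_gen; apply/WN/WS.
by rewrite lieT_last lie_alternating.
Qed.

End Span.
End RootVectors.

(** Summation by parts; for e_j = E_jj it evaluates the weighted sum in the formula for K_r. *)
Lemma sum_weighted_diff (F : pzRingType) (V : lmodType F) (e : nat -> V) (m : nat) :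
  \sum_(j < m) j.+1%:R *: (e j - e j.+1) = \sum_(j < m.+1) e j - m.+1%:R *: e m.
Proof.
elim: m => [|m IH]; first by rewrite big_ord0 big_ord1 scale1r subrr.
rewrite big_ord_recr /= IH [in RHS]big_ord_recr /= scalerBr addrA subrK.
by rewrite -[m.+2]add1n natrD scalerDl scale1r opprD addrA addrK.
Qed.

(** * Matrix units, and the relations satisfied by the matrices K_j *)

Section GlGenerators.
Variables (R : realType) (n : nat).

(** Indices are natural numbers, to match [lieA], [lieT] and [lieS]; [inord] is faithful only up to
    n, hence the bounds in the lemmas below. *)
Definition glE (a b : nat) : gl R[i] n.+1 := delta_mx (inord a) (inord b).

Lemma glE_bracket a b c d : (a <= n)%N -> (b <= n)%N -> (c <= n)%N -> (d <= n)%N ->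
  [Lie glE a b, glE c d] = glE a d *+ (b == c) - glE c b *+ (d == a).
Proof.
have inord_eq x y : (x <= n)%N -> (y <= n)%N -> (inord x == inord y :> 'I_n.+1) = (x == y).
  by move=> xn yn; rewrite -val_eqE /= !inordK.
move=> an bn cn dn; rewrite -[LHS]/(gl_bracket _ _) /gl_bracket.
by rewrite !mul_delta_mx_cond !inord_eq.
Qed.

Lemma mulii : 'i%C * 'i%C = -1 :> R[i].
Proof. by rewrite -expr2 sqr_i. Qed.

Definition glD (a b : nat) : gl R[i] n.+1 := glE a b - glE b a.
Definition glS (a b : nat) : gl R[i] n.+1 := glE a b + glE b a.

Lemma glDC a b : glD a b = - glD b a.
Proof. by rewrite /glD opprB. Qed.

Lemma glSC a b : glS a b = glS b a.
Proof. by rewrite /glS addrC. Qed.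

Lemma gl_coef (p q : 'I_n.+1) :
  ((forall x y : gl R[i] n.+1, (x + y)%R p q = (x p q + y p q)%R) *
   (forall x : gl R[i] n.+1, (- x)%R p q = (- x p q)%R) *
   (forall t (x : gl R[i] n.+1), (t *: x)%R p q = (t * x p q)%R) *
   ((0%R : gl R[i] n.+1) p q = 0%R))%type.
Proof. by do !split => *; exact: mxE. Qed.

(** Expands into brackets of matrix units, decides the Kronecker deltas by arithmetic, and compares
    entries. *)
Ltac expand_brackets :=
  rewrite /glD /glS ?(lieDl, lieDr, lieNl, lieNr) ?glE_bracket; [|lia..];
  rewrite ?eqxx;
  repeat match goal with |- context [GRing.natmul _ (nat_of_bool (?x == ?y))] =>
    (have -> : (x == y) = false by lia) end;
  rewrite ?(mulr0n, mulr1n, subr0, sub0r, addr0, add0r, oppr0, opprK);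
  move: (glE) => e; apply/(@matrixP R[i] n.+1 n.+1) => p q; rewrite ?gl_coef; ring.

Lemma glDD a b c : (a <= n)%N -> (b <= n)%N -> (c <= n)%N -> a != b -> b != c -> a != c ->
  [Lie glD a b, glD b c] = glD a c.
Proof. by move=> *; expand_brackets. Qed.

Lemma glDD0 a b c d : (a <= n)%N -> (b <= n)%N -> (c <= n)%N -> (d <= n)%N ->
  a != c -> a != d -> b != c -> b != d -> [Lie glD a b, glD c d] = 0.
Proof. by move=> *; expand_brackets. Qed.

Lemma glDE a b : (a <= n)%N -> (b <= n)%N -> a != b -> [Lie glD a b, glE b b] = glS a b.
Proof. by move=> *; expand_brackets. Qed.

Lemma glDE0 a b c : (a <= n)%N -> (b <= n)%N -> (c <= n)%N -> a != c -> b != c ->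
  [Lie glD a b, glE c c] = 0.
Proof. by move=> *; expand_brackets. Qed.

Lemma glDS a b : (a <= n)%N -> (b <= n)%N -> a != b ->
  [Lie glD a b, glS a b] = 2 *: (glE a a - glE b b).
Proof. by move=> *; expand_brackets. Qed.

Lemma glES a b : (a <= n)%N -> (b <= n)%N -> a != b -> [Lie glE b b, glS a b] = - glD a b.
Proof. by move=> *; expand_brackets. Qed.

Definition glK_nat (a : nat) : gl R[i] n.+1 := glK R (inord a).

Lemma glK_natE a : (a < n)%N -> glK_nat a = glD a a.+1.
Proof. by move=> an; apply: glK_lt; rewrite !inordK //; lia. Qed.

Lemma glK_nat_last : glK_nat n = 'i%C *: glE n n.
Proof. by apply: glK_lastE; rewrite inordK. Qed.

Lemma glK_nat_far j k : (j.+1 < k)%N -> (k <= n)%N -> [Lie glK_nat j, glK_nat k] = 0.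
Proof.
move=> jk kn; rewrite glK_natE; last lia.
case: (ltngtP k n) => [kn'||kn']; [|lia|].
  by rewrite glK_natE // glDD0 //; lia.
by rewrite kn' glK_nat_last lieZr glDE0 ?scaler0 //; lia.
Qed.

Lemma glK_nat_up j : (j.+1 < n)%N ->
  [Lie glK_nat j, [Lie glK_nat j, glK_nat j.+1]] = - glK_nat j.+1.
Proof.
move=> jn; rewrite !glK_natE; [|lia..].
rewrite glDD; [|lia..]; rewrite glDC lieNl glDD //; lia.
Qed.

Lemma glK_nat_down j : (j < n)%N ->
  [Lie glK_nat j.+1, [Lie glK_nat j.+1, glK_nat j]] = - glK_nat j.
Proof.
move=> jn; rewrite (glK_natE jn).
case: (ltngtP j.+1 n) => [jn'||jn']; [|lia|].
  rewrite glK_natE // (lieC _ (glD j _)) glDD; [|lia..].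
  by rewrite (glDC j) opprK glDD ?(glDC j) ?opprK //; lia.
rewrite jn' glK_nat_last !lieZl !lieZr (lieC _ (glD j _)) glDE; [|lia..].
by rewrite lieNr glES ?scalerA -?expr2 ?sqr_i ?scaleN1r ?opprK //; lia.
Qed.

Lemma glK_nat_cube j : j.+1 = n ->
  [Lie glK_nat j, [Lie glK_nat j, [Lie glK_nat j, glK_nat n]]] =
    -4 *: [Lie glK_nat j, glK_nat n].
Proof.
move=> jn; have jn' : (j < n)%N by lia.
rewrite glK_nat_last (glK_natE jn') jn !lieZr glDE; [|lia..].
rewrite glDS; [|lia..]; rewrite lieZr lieDr lieNr glDE; [|lia..].
rewrite glDC lieNl glDE; [|lia..]; rewrite glSC -opprD -mulr2n -(scaler_nat 2 (glS j n)).
by rewrite -scaleNr !scalerA; congr (_ *: _); ring.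
Qed.

(** The condition under which the universal property of the presented algebra yields a homomorphism
    to gl. *)
Lemma glK_rel_eval s t : glK_rel s t -> lie_eval (@glK R n.+1) s = lie_eval (@glK R n.+1) t.
Proof.
case=> j k /=.
- move=> jk; rewrite -[j]inord_val -[k]inord_val.
  have [jk'|jk'] := ltnP j k; first by apply: glK_nat_far; have := ltn_ord k; lia.
  by apply/lie_comm/glK_nat_far; have := ltn_ord j; lia.
- move=> kj kr; rewrite -[j]inord_val -[k]inord_val kj scaleN1r.
  by apply: glK_nat_up; lia.
- move=> kj; have jn := ltn_ord k; rewrite -[j]inord_val -[k]inord_val kj scaleN1r.
  by apply: glK_nat_down; lia.
- move=> kj [kr]; rewrite -[j]inord_val -[k]inord_val kj -kj kr.
  by apply: glK_nat_cube; lia.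
Qed.

(** * The homomorphism from the presented algebra and its values on A, S and T *)

Definition gl_of_presented : presented (@glK_rel R n.+1) -> gl R[i] n.+1 :=
  presented_lift (@glK R n.+1).

HB.instance Definition _ := GRing.isLinear.Build R[i] (presented (@glK_rel R n.+1))
  (gl R[i] n.+1) _ gl_of_presented (presented_lift_linear glK_rel_eval).

Lemma gl_of_presented_bracket :
  {morph gl_of_presented : x y / [Lie x, y] >-> [Lie x, y]}.
Proof. exact: presented_lift_bracket glK_rel_eval. Qed.

Lemma gl_of_presented_gen j : gl_of_presented (pgen _ j) = glK R j.
Proof. exact: presented_lift_gen glK_rel_eval _. Qed.

Local Notation P := (presented (@glK_rel R n.+1)).
Local Notation phi := gl_of_presented.

Definition pK (a : nat) : P := pgen _ (inord a).

Let prel s t : glK_rel s t -> pclass (@glK_rel R n.+1) s = pclass _ t.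
Proof. by move=> st; apply/pclassP/lc_rel. Qed.

Let pclassZ (a : R[i]) s : pclass (@glK_rel R n.+1) (LScale a s) = a *: pclass _ s.
Proof. by rewrite -[RHS]/(pscale a _) pscaleE. Qed.

Let pclassD s t : pclass (@glK_rel R n.+1) (LAdd s t) = pclass _ s + pclass _ t.
Proof. by rewrite -[RHS]/(padd _ _) paddE. Qed.

Let pclassB s t : pclass (@glK_rel R n.+1) (LBracket s t) = [Lie pclass _ s, pclass _ t].
Proof. by rewrite -[RHS]/(pbracket _ _) pbracketE. Qed.

Lemma pK_far j k : (j.+1 < k)%N -> (k <= n)%N -> [Lie pK j, pK k] = 0.
Proof.
move=> jk kn; rewrite -pclassB; apply: prel; apply: glK_far.
by rewrite !inordK //; lia.
Qed.

Lemma pK_up j : (j.+1 < n)%N -> [Lie pK j, [Lie pK j, pK j.+1]] = - pK j.+1.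
Proof.
move=> jn; have := prel (@glK_up R n.+1 (inord j) (inord j.+1) _ _).
by rewrite pclassZ !pclassB scaleN1r; apply; rewrite !inordK; lia.
Qed.

Lemma pK_down j : (j < n)%N -> [Lie pK j.+1, [Lie pK j.+1, pK j]] = - pK j.
Proof.
move=> jn; have := prel (@glK_down R n.+1 (inord j) (inord j.+1) _).
by rewrite pclassZ !pclassB scaleN1r; apply; rewrite !inordK; lia.
Qed.

Lemma pK_cube j : j.+1 = n ->
  [Lie pK j, [Lie pK j, [Lie pK j, pK n]]] = -4 *: [Lie pK j, pK n].
Proof.
move=> jn; have := prel (@glK_last R n.+1 (inord j) (inord n) _ _).
by rewrite pclassZ !pclassB; apply; rewrite !inordK; lia.
Qed.

Local Notation A := (lieA pK).
Local Notation T := (lieT pK n).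
Local Notation S := (lieS pK n).

Let phiD x y : phi (x + y) = phi x + phi y. Proof. exact: linearD. Qed.
Let phiN x : phi (- x) = - phi x. Proof. exact: linearN. Qed.
Let phiZ a x : phi (a *: x) = a *: phi x. Proof. exact: linearZ. Qed.

Lemma phi_pK j : phi (pK j) = glK_nat j.
Proof. exact: gl_of_presented_gen. Qed.

Lemma phi_A j k : (j < k)%N -> (k <= n)%N -> phi (A j k) = glD j k.
Proof.
elim: k => // k IH jk kn; case: (ltngtP j k) => [jk'||->]; [|lia|].
  rewrite lieAS // gl_of_presented_bracket IH ?phi_pK ?glK_natE ?glDD //; lia.
by rewrite lieA_gen phi_pK glK_natE.
Qed.

Lemma phi_T j : (j <= n)%N -> phi (T j) = 'i%C *: glE j j.
Proof.
move: j; apply: downward_ind => [|j jn IH]; first by rewrite lieT_last phi_pK glK_nat_last.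
rewrite lieTS // phiD phiZ !gl_of_presented_bracket phi_pK glK_natE // IH.
rewrite lieZr glDE; [|lia..]; rewrite lieZr glDS; [|lia..].
rewrite scalerA mulrC -scalerA [2^-1 *: _]scalerA mulVf ?pnatr_eq0 // scale1r.
by rewrite -scalerDr addrC subrK.
Qed.

Lemma phi_S j k : (j < k)%N -> (k <= n)%N -> phi (S j k) = 'i%C *: glS j k.
Proof.
by move=> jk kn; rewrite gl_of_presented_bracket phi_A ?phi_T ?lieZr ?glDE //; lia.
Qed.

(** The equations A_jk = E_jk - E_kj, S_jk = i(E_jk + E_kj), T_j = iE_jj solved for the matrix
    units. *)
Definition pE (j k : nat) : P :=
  if (j < k)%N then 2^-1 *: (A j k - 'i%C *: S j k)
  else if (k < j)%N then - (2^-1 *: (A k j + 'i%C *: S k j))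
  else - 'i%C *: T j.

Lemma phi_pE j k : (j <= n)%N -> (k <= n)%N -> phi (pE j k) = glE j k.
Proof.
move=> jn kn; rewrite /pE; case: ltngtP => [jk|kj|->].
- rewrite phiZ phiD phiN phiZ phi_A // phi_S //.
  rewrite scalerA mulii scaleN1r opprK /glD /glS addrACA addNr addr0.
  by rewrite -mulr2n -(scaler_nat 2 (glE j k)) scalerA mulVf ?scale1r ?pnatr_eq0.
- rewrite phiN phiZ phiD phiZ phi_A // phi_S //.
  rewrite scalerA mulii scaleN1r /glD /glS opprD addrACA subrr add0r -opprD.
  by rewrite -mulr2n scalerN opprK -(scaler_nat 2 (glE j k)) scalerA mulVf ?scale1r ?pnatr_eq0.
- by rewrite phiZ phi_T // scalerA mulNr mulii opprK scale1r.
Qed.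

(** * A linear section of the homomorphism, and its image *)

Definition presented_of_gl (X : gl R[i] n.+1) : P :=
  \sum_(j < n.+1) \sum_(k < n.+1) X j k *: pE j k.

Lemma presented_of_glK : cancel presented_of_gl phi.
Proof.
move=> X; rewrite linear_sum {2}[X]matrix_sum_delta; apply: eq_bigr => j _.
rewrite linear_sum; apply: eq_bigr => k _; rewrite /= phiZ phi_pE ?leq_ord //.
by rewrite /glE !inord_val.
Qed.

Lemma presented_of_gl_linear : linear presented_of_gl.
Proof.
move=> a X Y; rewrite /presented_of_gl scaler_sumr -big_split; apply: eq_bigr => j _.
rewrite scaler_sumr -big_split; apply: eq_bigr => k _.
by rewrite /= !gl_coef scalerDl scalerA.
Qed.

Let presented_of_glE j k : (j <= n)%N -> (k <= n)%N -> presented_of_gl (glE j k) = pE j k.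
Proof.
move=> jn kn; rewrite /presented_of_gl (bigD1 (inord j)) //= [X in _ + X]big1 ?addr0.
  rewrite (bigD1 (inord k)) //= big1 ?addr0 => [|l lk].
    by rewrite /glE mxE !eqxx scale1r !inordK.
  by rewrite /glE mxE (negbTE lk) andbF scale0r.
by move=> l lj; rewrite big1 // => l' _; rewrite /glE mxE (negbTE lj) scale0r.
Qed.

(** The span of A, S and T, taken as the image of the section: once it is everything, the right
    inverse of [phi] is also a left inverse. *)
Definition in_span (x : P) : Prop := exists X, presented_of_gl X = x.

Let span0 : in_span 0.
Proof. by exists (0 - 0); rewrite -scaleN1r addrC presented_of_gl_linear scaleN1r addNr. Qed.

Let spanD a x y : in_span x -> in_span y -> in_span (a *: x + y).
Proof. by move=> [X <-] [Y <-]; exists (a *: X + Y); rewrite presented_of_gl_linear. Qed.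

Let spanE j k : (j <= n)%N -> (k <= n)%N -> in_span (pE j k).
Proof. by move=> jn kn; exists (glE j k); apply: presented_of_glE. Qed.

Let spanA j k : (j < k)%N -> (k <= n)%N -> in_span (A j k).
Proof.
move=> jk kn; have -> : A j k = -1 *: pE k j + pE j k.
  rewrite /pE jk ltnNge (ltnW jk) /= scaleN1r opprK -scalerDr addrACA addrN addr0.
  by rewrite -mulr2n -(scaler_nat 2 (A j k)) scalerA mulVf ?scale1r ?pnatr_eq0.
by apply: spanD; apply: spanE; lia.
Qed.

Let spanS j k : (j < k)%N -> (k <= n)%N -> in_span (S j k).
Proof.
move=> jk kn; have -> : S j k = 'i%C *: (1 *: pE j k + pE k j) + 0.
  rewrite addr0 scale1r /pE jk ltnNge (ltnW jk) /= -scalerBr opprD addrACA addrN add0r.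
  rewrite -opprD -mulr2n -(scaler_nat 2 ('i%C *: S j k)) scalerN [2^-1 *: _]scalerA
    mulVf ?pnatr_eq0 //.
  by rewrite scale1r scalerN scalerA mulii scaleN1r opprK.
by apply: spanD => //; apply: spanD; apply: spanE; lia.
Qed.

Let spanT j : (j <= n)%N -> in_span (T j).
Proof.
move=> jn; have -> : T j = 'i%C *: pE j j + 0.
  by rewrite addr0 /pE ltnn scalerA mulrN mulii opprK scale1r.
by apply: spanD => //; apply: spanE.
Qed.

Lemma span_ind (Q : P -> Prop) : Q 0 -> (forall a x y, Q x -> Q y -> Q (a *: x + y)) ->
  (forall j k, (j < k)%N -> (k <= n)%N -> Q (A j k)) ->
  (forall j k, (j < k)%N -> (k <= n)%N -> Q (S j k)) ->
  (forall j, (j <= n)%N -> Q (T j)) -> forall x, in_span x -> Q x.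
Proof.
move=> Q0 QD QA QS QT x [X <-].
have QZ a y : Q y -> Q (a *: y) by move=> Qy; rewrite -[_ *: _]addr0; apply: QD.
have Qadd y z : Q y -> Q z -> Q (y + z) by move=> Qy Qz; rewrite -[y]scale1r; apply: QD.
have QN y : Q y -> Q (- y) by rewrite -scaleN1r; apply: QZ.
apply: (big_ind Q) => // j _; apply: (big_ind Q) => // k _; apply: (QZ).
have jn := leq_ord j; have kn := leq_ord k.
rewrite /pE; case: ltngtP => jk.
- by apply/QZ/Qadd; [apply: QA | apply/QN/QZ/QS].
- by apply/QN/QZ/Qadd; [apply: QA | apply/QZ/QS].
- exact/QZ/QT.
Qed.

Lemma span_pK j x : (j <= n)%N -> in_span x -> in_span [Lie pK j, x].
Proof.
move=> jn; apply: (@span_ind (fun x => in_span [Lie pK j, x])).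
- by rewrite lie0r.
- by move=> a y z Wy Wz; rewrite lieDr lieZr; apply: spanD.
- by move=> k l kl ln; exact: (span_lieKA pK_far pK_up pK_down span0 spanD spanA spanS).
- move=> k l kl ln.
  exact: (span_lieKS pK_far pK_up pK_down pK_cube span0 spanD spanA spanS spanT).
- by move=> k kn; exact: (span_lieKT pK_far pK_up pK_down pK_cube span0 spanD spanS).
Qed.

Lemma span_full x : in_span x.
Proof.
(* Stability passes from the generators to all elements, a bracket acting as the commutator of two
   actions. *)
have Wbr s y : in_span y -> in_span [Lie pclass _ s, y].
  elim: s y => [j||s IHs t IHt|a s IHs|s IHs t IHt] y Wy.
  - have -> : pclass (@glK_rel R n.+1) (LGen j) = pK j by rewrite /pK inord_val.
    by apply: span_pK => //; apply: leq_ord.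
  - by rewrite [X in in_span X](_ : _ = 0) //; apply: lie0l.
  - by rewrite pclassD lieDl -[[Lie _ s, y]]scale1r; apply: spanD; [apply: IHs|apply: IHt].
  - by rewrite pclassZ lieZl -[_ *: _]addr0; apply: spanD => //; apply: IHs.
  - rewrite pclassB lieJl -scaleN1r addrC.
    by apply: spanD; [apply/IHt/IHs | apply/IHs/IHt].
(* The generators lie in the span: K_j = A_{j,j+1} for j < n, and K_n = T_n. *)
rewrite -(preprK x); elim: (prepr x) => [j||s IHs t IHt|a s IHs|s IHs t IHt].
- rewrite -[j]inord_val; have := leq_ord j; move: (j : nat) => {}j jn.
  case: (ltngtP j n) => [jn'||->]; [|lia|].
    have -> : pclass _ (LGen (inord j)) = A j j.+1 by rewrite lieA_gen.
    exact: spanA.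
  have -> : pclass _ (LGen (inord n)) = T n by rewrite lieT_last.
  exact: spanT.
- exact: span0.
- by rewrite pclassD -[pclass _ s]scale1r; apply: spanD.
- by rewrite pclassZ -[_ *: _]addr0; apply: spanD.
- by rewrite pclassB; apply: Wbr.
Qed.

Lemma gl_of_presentedK : cancel phi presented_of_gl.
Proof. by move=> x; have [X <-] := span_full x; rewrite presented_of_glK. Qed.

(** * Generation of gl, and the formula for the last generator *)

Lemma gl_generated (G : set (gl R[i] n.+1)) :
  lie_subalgebra G -> (forall j, G (glK R j)) -> forall X, G X.
Proof.
(* Surjectivity of [phi] makes X the value of a Lie term in the generators; induction on that term
   follows. *)
move=> [G0 GD GB] GK X; rewrite -[X]presented_of_glK -(preprK (presented_of_gl X)).
rewrite /gl_of_presented (presented_liftE glK_rel_eval).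
elim: (prepr _) => //= [s Gs t Gt|a s Gs|s Gs t Gt]; last exact: GB.
- by rewrite -[lie_eval _ s]scale1r; apply: GD.
- by rewrite -[_ *: _]addr0; apply: GD.
Qed.

Lemma glK_last_formula (k : 'I_n.+1) : k.+1 = n.+1 ->
  glK R k = ('i%C / n.+1%:R) *:
    (glZ R n.+1 - \sum_(p : 'I_n.+1 * 'I_n.+1 | p.2 == p.1.+1 :> nat)
                     p.1.+1%:R *: (delta_mx p.1 p.1 - delta_mx p.2 p.2)).
Proof.
move=> kn; have -> : k = inord n by apply/val_inj; rewrite /= inordK //; case: kn.
rewrite -[glK R _]/(glK_nat n) glK_nat_last.
set s := \sum_(p | _) _.
have -> : s = glZ R n.+1 - n.+1%:R *: glE n n.
  have -> : glZ R n.+1 = \sum_(j < n.+1) glE j j.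
    by apply: eq_bigr => j _; rewrite /glE inord_val.
  rewrite -(sum_weighted_diff (fun j => glE j j)) /s.
  rewrite -(pair_big_dep xpredT (fun j l : 'I_n.+1 => l == j.+1 :> nat)
    (fun j l => j.+1%:R *: (delta_mx j j - delta_mx l l))) /=.
  (* The last index has no successor, so its inner sum is empty. *)
  rewrite big_ord_recr /= [X in _ + X]big_pred0 ?addr0; last first.
    by move=> l; have := ltn_ord l; lia.
  apply: eq_bigr => j _; have jn := ltn_ord j.
  rewrite (big_pred1 (inord j.+1)) => [|l]; last by rewrite /= -val_eqE /= inordK.
  by congr (_ *: (_ - _)); congr delta_mx; apply/val_inj; rewrite /= inordK //; lia.
by rewrite opprB addrC subrK scalerA divfK ?pnatr_eq0.
Qed.

End GlGenerators.

Theorem corollary4p1 (R : realType) (r : nat) (hr : (1 <= r)%N) :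
  [/\ forall k : 'I_r, k.+1 = r ->
        glK R k = 'i%C *: delta_mx k k /\
        glK R k = ('i%C / r%:R) *:
          (glZ R r - \sum_(p : 'I_r * 'I_r | p.2 == p.1.+1 :> nat)
                       p.1.+1%:R *: (delta_mx p.1 p.1 - delta_mx p.2 p.2)),
      lie_generated (range (@glK R r)) = setT &
      exists phi : {linear presented (@glK_rel R r) -> gl R[i] r},
        [/\ {morph phi : x y / [Lie x, y] >-> [Lie x, y]},
            forall j : 'I_r, phi (pgen (@glK_rel R r) j) = glK R j &
            bijective phi]].
Proof.
case: r hr => // n _; split=> [k kn||].
- by split; [exact: glK_lastE | exact: glK_last_formula].
- apply/seteqP; split=> // X _ G [Galg GK].
  by apply: gl_generated => // j; apply: GK; exists j.
exists (gl_of_presented (R:=R) (n:=n)); split.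
- exact: gl_of_presented_bracket.
- exact: gl_of_presented_gen.
- by exists (@presented_of_gl R n); [exact: gl_of_presentedK | exact: presented_of_glK].
Qed.
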